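(* Let $\sigma_0>0$, $\sigma_1>0$, let $g:\mathbb{R}\to\mathbb{R}$ be continuous with $g(\vartheta)>0$ for all $\vartheta$, let $f:\mathbb{R}\to\mathbb{R}$ be continuous with $f(0)=0$, and let $x_0\in\mathbb{R}$. Let $u_{\min,1}\le u_{\min,2}<u_{\max,1}\le u_{\max,2}$ be reals with $u_{\min,1}\neq u_{\min,2}$ or $u_{\max,1}\neq u_{\max,2}$, let $0<t_1<t_2<t_3<t_4$, and let $u:\mathbb{R}^+\to\mathbb{R}$ be a bimodal input as defined in the context (with period $T=t_4$). Consider the LuGre model with input $u$, its hysteresis loop $G_u^\circ$ and its minor loop $\mathcal{N}_u$ as defined in the context. Put $a=\sigma_0/g(0)$ and $$\varrho_0=0,\quad \varrho_1=u_{\max,1}-u_{\min,1},\quad \varrho_2=\varrho_1+u_{\max,1}-u_{\min,2},\quad \varrho_3=\varrho_2+u_{\max,2}-u_{\min,2},\quad \varrho_4=\varrho_3+u_{\max,2}-u_{\min,1},$$ so that $0<\varrho_1<\varrho_2<\varrho_3<\varrho_4$. Define $\psi_u:[0,\varrho_4]\to\mathbb{R}$ by $$\psi_u(t)=\begin{cases} t+u_{\min,1}, & t\in[0,\varrho_1],\\ -t+\varrho_1+u_{\max,1}, & t\in[\varrho_1,\varrho_2],\\ t-\varrho_2+u_{\min,2}, & t\in[\varrho_2,\varrho_3],\\ -t+\varrho_3+u_{\max,2}, & t\in[\varrho_3,\varrho_4].\end{cases}$$ Define $y^\circ:[0,\varrho_4]\to\mathbb{R}$ by $$y^\circ(0)=g(0)\,\frac{\mathrm{e}^{-a\varrho_4}}{1-\mathrm{e}^{-a\varrho_4}}\Big(2\mathrm{e}^{a\varrho_1}-2\mathrm{e}^{a\varrho_2}+2\mathrm{e}^{a\varrho_3}-\mathrm{e}^{a\varrho_4}-1\Big),$$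 $$y^\circ(\varrho_i)=\mathrm{e}^{-a(\varrho_i-\varrho_{i-1})}\Big(y^\circ(\varrho_{i-1})+(-1)^{i-1}g(0)\big[\mathrm{e}^{a(\varrho_i-\varrho_{i-1})}-1\big]\Big),\quad i\in\{1,2,3,4\},$$ and, for $i\in\{0,1,2,3\}$ and $t\in[\varrho_i,\varrho_{i+1}]$, $$y^\circ(t)=\mathrm{e}^{-a(t-\varrho_i)}\Big(y^\circ(\varrho_i)+(-1)^{i}g(0)\big[\mathrm{e}^{a(t-\varrho_i)}-1\big]\Big).$$ Then: (a) the hysteresis loop is $G_u^\circ=\{(\psi_u(t),y^\circ(t)) : t\in[0,\varrho_4]\}$; (b) the minor loop is $\mathcal{N}_u=\{(\psi_u(t),y^\circ(t)) : t\in[\varrho_1,\varrho_5]\}$, where $\varrho_5=u_{\max,1}-u_{\min,2}+\varrho_2\in(\varrho_2,\varrho_3]$.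
   Context: Bimodal input: $u:\mathbb{R}^+\to\mathbb{R}$ is absolutely continuous with $u$ and $\dot u$ essentially bounded (i.e. $u\in W^{1,\infty}(\mathbb{R}^+,\mathbb{R})$), $t_4$-periodic, strictly increasing on $[0,t_1]$, strictly decreasing on $[t_1,t_2]$, strictly increasing on $[t_2,t_3]$, strictly decreasing on $[t_3,t_4]$, with $u(0)=u_{\min,1}$, $u(t_1)=u_{\max,1}$, $u(t_2)=u_{\min,2}$, $u(t_3)=u_{\max,2}$, $u(t_4)=u(0)$. LuGre model: state $x$ and output $F$ given by $\dot x(t)=-\sigma_0\frac{|\dot u(t)|}{g(\dot u(t))}x(t)+\dot u(t)$, $x(0)=x_0$, $F(t)=\sigma_0x(t)+\sigma_1\dot x(t)+f(\dot u(t))$ (Carathéodory solutions). For $\gamma>0$, applying the slowed input $t\mapsto u(t/\gamma)$ and rescaling time back gives the system $\dot z_\gamma(t)=-\sigma_0\frac{|\dot u(t)|}{g(\dot u(t)/\gamma)}z_\gamma(t)+\dot u(t)$, $z_\gamma(0)=x_0$, with output $y_\gamma(t)=\sigma_0 z_\gamma(t)+\frac{\sigma_1}{\gamma}\dot z_\gamma(t)+f(\dot u(t)/\gamma)$. It is known (from prior work) that $y_\gamma$ converges in $L^\infty(\mathbb{R}^+,\mathbb{R})$ as $\gamma\to\infty$ to a function $y^\star_u$, and that, with $T=t_4$, the functions $y^\star_{u,k}(t)=y^\star_u(t+kT)$, $t\in[0,T]$, converge in $L^\infty([0,T],\mathbb{R})$ as $k\to\infty$ to a function $y^\circ_u$.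 The hysteresis loop corresponding to $u$ is $G_u^\circ=\{(u(t),y^\circ_u(t)) : t\in[0,T]\}$. The minor loop corresponding to $u$ is the portion $\mathcal{N}_u=\{(u(t),y^\circ_u(t)) : t\in[t_1,t_5]\}$, where $t_5\in(t_2,t_3]$ is the time with $u(t_5)=u(t_1)$.
   Formalization: Since an L^∞ limit is only defined almost everywhere, y°_u is taken to be its continuous representative on [0,T]; the immediate remarks 0<ϱ1<ϱ2<ϱ3<ϱ4 and ϱ5∈(ϱ2,ϱ3] are not stated separately. *)

(* Defs.v *)
From mathcomp Require Import all_boot all_order all_algebra.
From mathcomp Require Import all_classical all_reals all_analysis.
Set Implicit Arguments. Unset Strict Implicit. Unset Printing Implicit Defensive.
Import Order.TTheory GRing.Theory Num.Theory.
Import numFieldNormedType.Exports.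
Local Open Scope classical_set_scope.
Local Open Scope ring_scope.

Section LuGre.
Variable R : realType.
Local Notation mu := (@lebesgue_measure R).

(* u in W^{1,oo}(R^+,R) with a.e.-derivative du:
   du is measurable and essentially bounded on [0,oo), u is bounded on [0,oo),
   and u(t) = u(0) + int_0^t du (i.e. u is absolutely continuous with u' = du a.e.). *)
Definition W1inf_with_deriv (u du : R -> R) : Prop :=
  [/\ measurable_fun (`[0, +oo[ : set R) du,
      (exists M : R, {ae mu, forall t, 0 <= t -> `|du t| <= M}),
      (exists M : R, forall t, 0 <= t -> `|u t| <= M) &
      (forall t, 0 <= t ->
        mu.-integrable `[0, t] (fun s => (du s)%:E) /\
        u t = u 0 + \int[mu]_(s in `[0, t]) du s)].

Definition strict_incr_on (u : R -> R) (a b : R) : Prop :=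
  forall x y, a <= x -> x < y -> y <= b -> u x < u y.
Definition strict_decr_on (u : R -> R) (a b : R) : Prop :=
  forall x y, a <= x -> x < y -> y <= b -> u y < u x.

Definition bimodal_input (u : R -> R) (t1 t2 t3 t4 umin1 umax1 umin2 umax2 : R)
  : Prop :=
  [/\ (forall t, 0 <= t -> u (t + t4) = u t),
      [/\ strict_incr_on u 0 t1, strict_decr_on u t1 t2,
      strict_incr_on u t2 t3 & strict_decr_on u t3 t4] &
      [/\ u 0 = umin1, u t1 = umax1, u t2 = umin2, u t3 = umax2 & u t4 = u 0]].

Definition lugre_rhs (sigma0 : R) (g : R -> R) (du : R -> R) (gamma : R)
  (z : R -> R) (s : R) : R :=
  - sigma0 * `|du s| / g (du s / gamma) * z s + du s.

Definition caratheodory_sol (sigma0 : R) (g du : R -> R) (gamma x0 : R)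
  (z : R -> R) : Prop :=
  forall t, 0 <= t ->
    mu.-integrable `[0, t] (fun s => (lugre_rhs sigma0 g du gamma z s)%:E) /\
    z t = x0 + \int[mu]_(s in `[0, t]) lugre_rhs sigma0 g du gamma z s.

(* Output y_gamma = sigma0 z + (sigma1/gamma) z' + f(u'/gamma), where z' is
   (a.e.) the right-hand side of the state equation. *)
Definition lugre_output (sigma0 sigma1 : R) (g f du : R -> R) (gamma : R)
  (z : R -> R) (t : R) : R :=
  sigma0 * z t + sigma1 / gamma * lugre_rhs sigma0 g du gamma z t
  + f (du t / gamma).

Definition Linf_cvg_gamma (y : R -> R -> R) (ystar : R -> R) : Prop :=
  forall eps : R, 0 < eps -> exists G : R, forall gamma : R, G <= gamma -> 0 < gamma ->
    {ae mu, forall t, 0 <= t -> `|y gamma t - ystar t| <= eps}.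

Definition Linf_cvg_periods (ystar : R -> R) (T : R) (yo : R -> R) : Prop :=
  forall eps : R, 0 < eps -> exists K : nat, forall k : nat, (K <= k)%N ->
    {ae mu, forall t, 0 <= t <= T -> `|ystar (t + k%:R * T) - yo t| <= eps}.

Definition rho1 (umin1 umax1 umin2 umax2 : R) := umax1 - umin1.
Definition rho2 (umin1 umax1 umin2 umax2 : R) :=
  rho1 umin1 umax1 umin2 umax2 + umax1 - umin2.
Definition rho3 (umin1 umax1 umin2 umax2 : R) :=
  rho2 umin1 umax1 umin2 umax2 + umax2 - umin2.
Definition rho4 (umin1 umax1 umin2 umax2 : R) :=
  rho3 umin1 umax1 umin2 umax2 + umax2 - umin1.
Definition rho5 (umin1 umax1 umin2 umax2 : R) :=
  umax1 - umin2 + rho2 umin1 umax1 umin2 umax2.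

Definition psi_u (umin1 umax1 umin2 umax2 : R) (t : R) : R :=
  let r1 := rho1 umin1 umax1 umin2 umax2 in
  let r2 := rho2 umin1 umax1 umin2 umax2 in
  let r3 := rho3 umin1 umax1 umin2 umax2 in
  if t <= r1 then t + umin1
  else if t <= r2 then - t + r1 + umax1
  else if t <= r3 then t - r2 + umin2
  else - t + r3 + umax2.

Definition ypiece (a g0 : R) (i : nat) (rhoi Y t : R) : R :=
  expR (- a * (t - rhoi)) * (Y + (-1) ^+ i * g0 * (expR (a * (t - rhoi)) - 1)).

Definition ycirc (sigma0 : R) (g : R -> R) (umin1 umax1 umin2 umax2 : R)
  (t : R) : R :=
  let g0 := g 0 in
  let a := sigma0 / g0 in
  let r1 := rho1 umin1 umax1 umin2 umax2 in
  let r2 := rho2 umin1 umax1 umin2 umax2 in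
  let r3 := rho3 umin1 umax1 umin2 umax2 in
  let r4 := rho4 umin1 umax1 umin2 umax2 in
  let Y0 := g0 * (expR (- a * r4) / (1 - expR (- a * r4))) *
            (2 * expR (a * r1) - 2 * expR (a * r2) + 2 * expR (a * r3)
             - expR (a * r4) - 1) in
  let Y1 := ypiece a g0 0 0 Y0 r1 in
  let Y2 := ypiece a g0 1 r1 Y1 r2 in
  let Y3 := ypiece a g0 2 r2 Y2 r3 in
  if t <= r1 then ypiece a g0 0 0 Y0 t
  else if t <= r2 then ypiece a g0 1 r1 Y1 t
  else if t <= r3 then ypiece a g0 2 r2 Y2 t
  else ypiece a g0 3 r3 Y3 t.

End LuGre.

(* Main.v *)
Require Import Defs.
From mathcomp Require Import all_boot all_order all_algebra.
From mathcomp Require Import all_classical all_reals all_analysis.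
From mathcomp Require Import measurable_realfun ring lra.
Set Implicit Arguments. Unset Strict Implicit. Unset Printing Implicit Defensive.
Import Order.TTheory GRing.Theory Num.Theory.
Import numFieldNormedType.Exports.
Local Open Scope classical_set_scope.
Local Open Scope ring_scope.

(** In the variation time [rho = int |u'|] the limit of the output equation reads
    [dy / drho = a * (e * g 0 - y)] on a piece where [u'] has sign [e], whatever the
    shape of [u] there; [ypiece] is its solution.  The error between the state
    [z_gamma] and the corresponding limit state is damped: outside a ball whose radius
    vanishes as [gamma] grows, it decreases at a rate bounded below per unit of
    variation.  Every period contributes the same positive variation, so that after
    finitely many periods, uniformly in large [gamma], the output is close to the
    periodic solution of the limit equation.  Hence [yo] equals this solution almost
    everywhere, then everywhere by continuity, and the image of the loop does not
    change when it is parametrized by the variation of [u]. *)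

Definition nondecr_on (R : realType) (F : R -> R) (p q : R) : Prop :=
  forall x y, p <= x -> x <= y -> y <= q -> F x <= F y.

Section RealFunctions.
Variable R : realType.
Implicit Types (F phi dphi : R -> R) (p q s t x y e B : R).

Lemma within_itv_continuous_dist F p q : {within `[p, q], continuous F} ->
  forall x e, p <= x <= q -> 0 < e -> exists2 d, 0 < d &
    forall y, p <= y <= q -> `|x - y| < d -> `|F x - F y| < e.
Proof.
move=> /subspace_continuousP Fc x e xpq e0.
have /Fc/cvgrPdist_lt/(_ e e0) : `[p, q]%classic x by rewrite /= in_itv.
rewrite /within/= => /nbhs_ballP[d /= d0 Fd].
by exists d => // y ypq xy; apply: Fd; rewrite //= in_itv.
Qed.

Lemma within_itv_continuousS F p q s t : p <= s -> t <= q ->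
  {within `[p, q], continuous F} -> {within `[s, t], continuous F}.
Proof.
move=> ps tq; apply: continuous_subspaceW.
by apply: subset_itvScc; rewrite bnd_simp.
Qed.

Lemma last_exit F p q B : p <= q -> {within `[p, q], continuous F} ->
  F p <= B -> B < F q ->
  exists s, [/\ p <= s, s < q, F s <= B & forall t, s < t -> t <= q -> B < F t].
Proof.
move=> pq /within_itv_continuous_dist Fc FpB BFq.
pose S := [set s | p <= s <= q /\ F s <= B].
have Sp : S p by rewrite /S /= lexx.
have supS : has_sup S by split; [exists p | exists q => x [/andP[]]].
have leS x : S x -> x <= sup S by exact: (ub_le_sup supS.2).
have Sq : sup S <= q by apply: ge_sup; [exists p | move=> x [/andP[]]].
have spq : p <= sup S <= q by rewrite leS.
have FS : F (sup S) <= B.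
  rewrite leNgt; apply/negP => BFS; rewrite -subr_gt0 in BFS.
  have [d d0 Fd] := Fc _ _ spq BFS.
  have [x Sx xd] := sup_adherent d0 supS; have [xpq FxB] := Sx.
  have := Fd x xpq; rewrite ger0_norm ?subr_ge0 ?leS// ltr_norml; lra.
exists (sup S); split=> [||//|t St tq]; first exact: leS.
  by rewrite lt_neqAle Sq andbT; apply: contraTneq BFq => <-; rewrite -leNgt.
rewrite ltNge; apply: contraTN (St) => FtB; rewrite -leNgt; apply: (leS).
by split=> //; rewrite tq andbT (le_trans _ (ltW St))// leS.
Qed.

Lemma right_nonincr_le F p q : p <= q -> {within `[p, q], continuous F} ->
  (forall s, p <= s -> s < q -> exists2 t, s < t <= q & F t <= F s) -> F q <= F p.
Proof.
move=> pq Fc Fs; rewrite leNgt; apply/negP => Fpq.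
have [s [ps sq FsB Bt]] := last_exit pq Fc (lexx (F p)) Fpq.
have [t /andP[st tq] Fts] := Fs s ps sq.
by have := Bt t st tq; lra.
Qed.

Lemma mean_value_comp phi dphi F s t : (forall x, is_derive x 1 phi (dphi x)) ->
  s <= t -> {within `[s, t], continuous F} ->
  exists2 c, s <= c <= t &
    phi (F t) - phi (F s) = dphi (F c) * (F t - F s).
Proof.
move=> dphiE st Fc.
have phic p q : {within `[p, q], continuous phi}.
  by apply: derivable_within_continuous => x _; exact: ex_derive.
have hit y : Num.min (F s) (F t) <= y <= Num.max (F s) (F t) ->
    exists2 c, s <= c <= t & F c = y.
  by move=> /(IVT st Fc)[c]; rewrite in_itv; exists c.
have [Fst|/ltW Fts] := leP (F s) (F t).
  have [y] := MVT_segment Fst (fun x _ => dphiE x) (phic _ _).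
  rewrite in_itv/= -{1}(min_l Fst) -{2}(max_r Fst) => /hit[c ct <-] phiE.
  by exists c.
have [y] := MVT_segment Fts (fun x _ => dphiE x) (phic _ _).
rewrite in_itv/= -{1}(min_r Fts) -{2}(max_l Fts) => /hit[c ct <-] phiE.
by exists c => //; rewrite -opprB phiE; ring.
Qed.

Lemma image_reparam (X : Type) (phi chi : R -> X) F p q : p <= q ->
  {within `[p, q], continuous F} -> nondecr_on F p q ->
  (forall t, p <= t <= q -> chi (F t) = phi t) ->
  [set phi t | t in `[p, q]] = [set chi s | s in `[F p, F q]].
Proof.
move=> pq Fc Fmono chiF; have Fpq := Fmono p q (lexx _) pq (lexx _).
apply/seteqP; split => _ [t + <-] /=; rewrite /= in_itv/= => /andP[pt tq].
  exists (F t); last by rewrite chiF ?pt.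
  by rewrite /= in_itv/= !Fmono.
have [|c] := @IVT _ F p q t pq Fc; first by rewrite min_l// max_r// pt.
by rewrite in_itv/= => cpq <-; exists c; rewrite ?chiF//= in_itv.
Qed.

End RealFunctions.

(** * Primitives of integrable functions *)

Local Instance ae_lebesgue_filter (R : realType) :
  Filter (nbhs (almost_everywhere (@lebesgue_measure R))).
Proof. exact: ae_filter_ringOfSetsType. Qed.

Section Primitives.
Variable R : realType.
Local Notation mu := (@lebesgue_measure R).
Implicit Types (F G I V f g h : R -> R) (p q s t c e : R).

Lemma integrable_itvS f p q s t : p <= s -> t <= q ->
  mu.-integrable `[p, q] (EFin \o f) -> mu.-integrable `[s, t] (EFin \o f).
Proof.
move=> ps tq; apply: integrableS => //.
by apply: subset_itvScc; rewrite bnd_simp.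
Qed.

Lemma integrable_itv_continuousM h f p q : {within `[p, q], continuous h} ->
  mu.-integrable `[p, q] (EFin \o f) ->
  mu.-integrable `[p, q] (EFin \o (fun x => h x * f x)).
Proof.
move=> hc; apply: (@integrableMr _ _ _ mu _ _ h (EFin \o f)) => //.
  exact: subspace_continuous_measurable_fun.
have [M [Mreal hM]] := compact_bounded (continuous_compact hc (@segment_compact R p q)).
by exists M; split=> // N /hM hN x xpq; apply: hN; exists x.
Qed.

Lemma Rintegral_ae_ge0 (D : set R) f : measurable D ->
  mu.-integrable D (EFin \o f) -> {ae mu, forall x, D x -> 0 <= f x} ->
  0 <= \int[mu]_(x in D) f x.
Proof.
move=> mD fi f0.
have mf : measurable_fun D f by apply/measurable_EFinP; exact: measurable_int fi.
have -> : \int[mu]_(x in D) f x = \int[mu]_(x in D) `|f x|.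
  congr fine; apply: ae_eq_integral => //.
  - exact/measurable_EFinP.
  - by apply/measurable_EFinP; exact: measurableT_comp.
  - by apply: filterS f0 => x + Dx => /(_ Dx) /ger0_norm /= ->.
exact: Rintegral_ge0.
Qed.

Definition primitive F f p q : Prop :=
  mu.-integrable `[p, q] (EFin \o f) /\
  forall s t, p <= s -> s <= t -> t <= q -> F t - F s = \int[mu]_(x in `[s, t]) f x.

Lemma primitiveS F f p q s t : p <= s -> t <= q ->
  primitive F f p q -> primitive F f s t.
Proof.
move=> ps tq [fi FE]; split; first exact: integrable_itvS fi.
by move=> x y sx xy yt; apply: FE; [exact: le_trans sx| |exact: le_trans tq].
Qed.

Lemma primitive_integral F f c p q :
  mu.-integrable `[p, q] (EFin \o f) ->
  (forall t, p <= t <= q -> F t = c + \int[mu]_(x in `[p, t]) f x) ->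
  primitive F f p q.
Proof.
move=> fi FE; split=> // s t ps st tq.
rewrite !FE ?ps ?(le_trans ps st) ?(le_trans st tq)// opprD addrACA subrr add0r.
rewrite Rintegral_itvB ?bnd_simp//; last exact: integrable_itvS fi.
rewrite Rintegral_itv_obnd_cbnd//; apply: integrableS fi => //.
by apply: subset_itv; rewrite bnd_simp.
Qed.

Lemma primitive_halfline F f c p q : 0 <= p ->
  (forall t, 0 <= t -> mu.-integrable `[0, t] (EFin \o f) /\
     F t = c + \int[mu]_(s in `[0, t]) f s) ->
  p <= q -> primitive F f p q.
Proof.
move=> p0 FE pq; apply: (primitiveS p0 (lexx q)).
apply: (primitive_integral (c := c) (FE q (le_trans p0 pq)).1).
by move=> t /andP[/FE[]].
Qed.

Lemma primitiveB F f G g p q : primitive F f p q -> primitive G g p q ->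
  primitive (fun x => F x - G x) (fun x => f x - g x) p q.
Proof.
move=> [fi FE] [gi GE]; split.
  exact: (@integrableB _ _ _ mu _ _ (EFin \o f) (EFin \o g)).
move=> s t ps st tq; rewrite RintegralB ?(integrable_itvS ps tq)//.
by rewrite -FE// -GE//; ring.
Qed.

Lemma primitiveZ c F f p q : primitive F f p q ->
  primitive (fun x => c * F x) (fun x => c * f x) p q.
Proof.
move=> [fi FE]; split.
  exact: (@integrableZl _ _ _ mu _ _ c (EFin \o f)).
move=> s t ps st tq; rewrite RintegralZl ?(integrable_itvS ps tq)//.
by rewrite -FE// mulrBr.
Qed.

Lemma primitive_continuous F f p q : primitive F f p q -> p <= q ->
  {within `[p, q], continuous F}.
Proof.
move=> [fi FE] pq.
pose I x := \int[mu]_(y in `[p, x]) f y.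
have Ic : {within `[p, q], continuous I} := parameterized_integral_continuous pq fi.
apply: (@subspace_eq_continuous _ _ _ (fun x => I x + F p)).
  move=> x; rewrite inE/= in_itv/= => /andP[px xq].
  by rewrite /from_subspace /I -FE// subrK.
by apply: (within_continuousD Ic) => x; exact: cvg_cst.
Qed.

Lemma primitive_ae_ge0_nondecr F f p q : primitive F f p q ->
  {ae mu, forall x, p <= x <= q -> 0 <= f x} -> nondecr_on F p q.
Proof.
move=> [fi FE] f0 s t ps st tq; rewrite -subr_ge0 FE//.
apply: Rintegral_ae_ge0; [exact: measurable_itv|exact: integrable_itvS fi|].
apply: filterS f0 => x f0; rewrite /= in_itv/= => /andP[sx xt].
by rewrite f0// (le_trans ps)// (le_trans xt).
Qed.

Lemma primitive_le F f G g p q : p <= q -> primitive F f p q ->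
  primitive G g p q -> {ae mu, forall x, p <= x <= q -> f x <= g x} ->
  F q - F p <= G q - G p.
Proof.
move=> pq Ff Gg fg.
have gf_ge0 : {ae mu, forall x, p <= x <= q -> 0 <= g x - f x}.
  by apply: filterS fg => x; rewrite subr_ge0.
have := primitive_ae_ge0_nondecr (primitiveB Gg Ff) gf_ge0 (lexx p) pq (lexx q).
lra.
Qed.

Lemma eq_ae_primitive F f g p q : mu.-integrable `[p, q] (EFin \o g) ->
  {ae mu, forall x, p <= x <= q -> f x = g x} ->
  primitive F f p q -> primitive F g p q.
Proof.
move=> gi fg [fi FE]; split=> // s t ps st tq; rewrite FE//.
congr fine; apply: ae_eq_integral => //.
- exact: measurable_int (integrable_itvS ps tq fi).
- exact: measurable_int (integrable_itvS ps tq gi).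
apply: filterS fg => x fg /=; rewrite in_itv/= => /andP[sx xt].
by rewrite fg// (le_trans ps)//= (le_trans xt).
Qed.

(* No bound on [f] is needed: immediately to the right of every point the increments
   of [phi \o F] and of [I] differ by at most [e] times those of [V], and
   [right_nonincr_le] makes this estimate global. *)
Section ChainRule.
Variables (phi dphi : R -> R).
Hypothesis dphiE : forall x : R, is_derive x 1 phi (dphi x).

Lemma comp_increment_osc F f I V s t e : s <= t ->
  primitive F f s t -> primitive I (fun x => dphi (F x) * f x) s t ->
  primitive V (fun x => `|f x|) s t ->
  (forall x y, s <= x <= t -> s <= y <= t -> `|dphi (F x) - dphi (F y)| <= e) ->
  `|phi (F t) - phi (F s) - (I t - I s)| <= e * (V t - V s).
Proof.
move=> st Ff Ip Vp osc.
have [c ct ->] := mean_value_comp dphiE st (primitive_continuous Ff st).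
set k := dphi (F c); have rem_p := primitiveB (primitiveZ k Ff) Ip.
rewrite normrEsign; move: (_ < 0) => b.
have := primitive_le st (primitiveZ ((-1) ^+ b) rem_p) (primitiveZ e Vp).
have /[swap]/[apply] : {ae mu, forall x, s <= x <= t ->
    (-1) ^+ b * (k * f x - dphi (F x) * f x) <= e * `|f x|}.
  apply: aeW => x xst; rewrite (le_trans (ler_norm _))// normrM normr_sign mul1r.
  by rewrite -mulrBl normrM ler_wpM2r// osc.
lra.
Qed.

Hypothesis dphi_cont : continuous dphi.

Lemma comp_increment_approx F f I V p q e : p <= q ->
  primitive F f p q -> primitive I (fun x => dphi (F x) * f x) p q ->
  primitive V (fun x => `|f x|) p q -> 0 < e ->
  `|phi (F q) - phi (F p) - (I q - I p)| <= e * (V q - V p).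
Proof.
move=> pq Ff Ip Vp e0; have Fc := primitive_continuous Ff pq.
have phic : continuous phi.
  by move=> x; apply/differentiable_continuous/derivable1_diffP; exact: ex_derive.
have dphiFc : {within `[p, q], continuous (dphi \o F)}.
  by apply: within_continuous_comp Fc => x _; exact: dphi_cont.
rewrite normrEsign; move: (_ < 0) => b.
pose excess x := (-1) ^+ b * (phi (F x) - I x) - e * V x.
suff : excess q <= excess p by rewrite /excess; lra.
apply: right_nonincr_le => //.
  have eVc := primitive_continuous (primitiveZ e Vp) pq.
  have Ic := primitive_continuous Ip pq.
  have phiFc : {within `[p, q], continuous (phi \o F)}.
    by apply: within_continuous_comp Fc => x _; exact: phic.
  move=> x; apply: continuousB (eVc x); apply: continuousM; first exact: cvg_cst.
  by apply: continuousB (Ic x); exact: phiFc.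
move=> s ps sq; have spq : p <= s <= q by rewrite ps ltW.
have [d d0 close] := within_itv_continuous_dist dphiFc spq (divr_gt0 e0 (ltr0n _ 2)).
pose t := Num.min q (s + d / 2).
have [st tq] : s < t /\ t <= q by rewrite ge_min lexx lt_min sq ltrDl divr_gt0.
have td : t <= s + d / 2 by rewrite ge_min lexx orbT.
exists t; rewrite ?st//.
have near_s x : s <= x <= t -> `|dphi (F s) - dphi (F x)| < e / 2.
  move=> /andP[sx xt]; apply: close; first lra.
  by rewrite distrC ger0_norm; lra.
have osc x y : s <= x <= t -> s <= y <= t -> `|dphi (F x) - dphi (F y)| <= e.
  by move=> /near_s + /near_s; rewrite !ltr_norml ler_norml; lra.
have incr_le := comp_increment_osc (ltW st) (primitiveS ps tq Ff) (primitiveS ps tq Ip)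
  (primitiveS ps tq Vp) osc.
suff : (-1) ^+ b * (phi (F t) - phi (F s) - (I t - I s)) <= e * (V t - V s).
  by rewrite /excess; lra.
by rewrite (le_trans (ler_norm _))// normrM normr_sign mul1r.
Qed.

Lemma primitive_comp F f p q : p <= q -> primitive F f p q ->
  primitive (fun x => phi (F x)) (fun x => dphi (F x) * f x) p q.
Proof.
move=> pq Ff; have [fi _] := Ff.
have dphiFc : {within `[p, q], continuous (dphi \o F)}.
  apply: within_continuous_comp (primitive_continuous Ff pq) => x _.
  exact: dphi_cont.
have dphiFfi := integrable_itv_continuousM dphiFc fi.
have Ip : primitive (fun x => \int[mu]_(y in `[p, x]) (dphi (F y) * f y))
    (fun x => dphi (F x) * f x) p q.
  by apply: (primitive_integral (c := 0) dphiFfi) => t _; rewrite add0r.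
have Vp : primitive (fun x => \int[mu]_(y in `[p, x]) `|f y|) (fun x => `|f x|) p q.
  apply: (primitive_integral (c := 0)); first exact: integrable_norm.
  by move=> t _; rewrite add0r.
split=> // s t ps st tq; rewrite -Ip.2//; apply/eqP; rewrite -subr_eq0 -normr_le0.
have approx e := comp_increment_approx st (primitiveS ps tq Ff)
  (primitiveS ps tq Ip) (primitiveS ps tq Vp) (e := e).
have V0 : 0 <= \int[mu]_(y in `[s, t]) `|f y| by exact: Rintegral_ge0.
rewrite /= Vp.2// in approx.
set V := Rintegral _ _ _ in V0 approx.
apply/ler_addgt0Pr => e e0; rewrite add0r.
have V1 : 0 < V + 1 by rewrite ltr_pwDr.
apply: le_trans (approx _ (divr_gt0 e0 V1)) _.
by rewrite mulrAC ler_pdivrMr// ler_wpM2l ?lerDl// ltW.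
Qed.

End ChainRule.

Lemma ae_neq (c : R) : {ae mu, forall x, x != c}.
Proof.
exists [set c]; split => //; first exact: lebesgue_measure_set1.
by move=> x /= /negP; rewrite negbK => /eqP.
Qed.

Lemma derive1_ge0_near F x : derivable F x 1 ->
  (\forall h \near 0^', 0 <= h^-1 * (F (h + x) - F x)) -> 0 <= derive1 F x.
Proof.
move=> dF quot_ge0; rewrite derive1E /derive; apply: limr_ge => //.
by apply: filterS quot_ge0 => h; rewrite /= /GRing.scale/= mulr1.
Qed.

Lemma primitive_nondecr_ae_ge0 F f p q : primitive F f p q -> nondecr_on F p q ->
  {ae mu, forall x, p <= x <= q -> 0 <= f x}.
Proof.
move=> [fi FE] Fmono.
pose g := f \_ `[p, q].
have gi : mu.-integrable setT (EFin \o g).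
  by rewrite -restrict_EFin; apply/integrable_restrict => //=; rewrite setTI.
pose G x := \int[mu]_(t in `[p, x]) g t.
have GF x y : p <= x -> x <= y -> y <= q -> G y - G x = F y - F x.
  have GF0 z : p <= z <= q -> G z = F z - F p.
    move=> /andP[pz zq]; rewrite FE//; apply: eq_Rintegral => t.
    rewrite inE/= in_itv/= => /andP[pt tz].
    by rewrite /g patchE mem_set//= in_itv/= pt (le_trans tz).
  by move=> px xy yq; rewrite !GF0 ?px ?(le_trans px xy) ?(le_trans xy yq)//; ring.
have gl : locally_integrable [set: R] g by exact: integrable_locally fi.
have gi_ray y : mu.-integrable [set` Interval (BLeft p) (BRight y)] (EFin \o g).
  exact: integrableS gi.
apply: filterS3 (FTC1 gi_ray gl) (ae_neq p) (ae_neq q) => x dG xp xq xpq.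
have {xp xq xpq}[px xq] : p < x /\ x < q by lra.
have [dGx] : derivable G x 1 /\ derive1 G x = g x by apply: dG; rewrite /= lte_fin.
rewrite /g patchE mem_set/=; last by rewrite in_itv/= !ltW.
move=> <-; apply: derive1_ge0_near => //.
have d0 : 0 < Num.min (x - p) (q - x) by rewrite lt_min !subr_gt0 px.
near=> h.
have : `|h| < Num.min (x - p) (q - x) by near: h; exact: dnbhs0_lt.
rewrite lt_min !ltr_norml => /andP[/andP[hp _] /andP[_ hq]].
have [h0|h0] := leP 0 h.
  rewrite GF; [|lra..]; rewrite mulr_ge0 ?invr_ge0// subr_ge0.
  by apply: Fmono; lra.
rewrite -mulrNN opprB GF; [|lra..].
rewrite mulr_ge0 ?oppr_ge0 ?invr_le0 ?(ltW h0)// subr_ge0.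
by apply: Fmono; lra.
Unshelve. all: by end_near. Qed.

Lemma ae_itv_exists (P : R -> Prop) s t : s < t -> {ae mu, forall x, P x} ->
  exists2 x, s < x < t & P x.
Proof.
move=> st [N [mN N0 PN]]; apply: contrapT => noP.
have : (mu `]s, t[%classic <= mu N)%E.
  apply: le_measure; rewrite ?inE//.
  move=> x; rewrite /= in_itv/= => sxt; apply: PN => /= Px.
  by apply: noP; exists x.
by rewrite N0 lebesgue_measure_itv/= lte_fin st -EFinD lee_fin subr_le0 leNgt st.
Qed.

Lemma ae_le_continuous F p q c : p < q -> {within `[p, q], continuous F} ->
  {ae mu, forall x, p <= x <= q -> F x <= c} -> forall t, p <= t <= q -> F t <= c.
Proof.
move=> pq /within_itv_continuous_dist Fc Fae t tpq.
rewrite leNgt; apply/negP; rewrite -subr_gt0 => ct.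
have [d d0 Fd] := Fc t _ tpq ct.
have : Num.max p (t - d) < Num.min q (t + d).
  by rewrite lt_min !gt_max; lra.
move=> /ae_itv_exists/(_ Fae)[x]; rewrite lt_min gt_max => xpqd Fxc.
have xpq : p <= x <= q by lra.
have := Fd x xpq; have := Fxc xpq; rewrite !ltr_norml; lra.
Qed.

Lemma ae_addr (P : R -> Prop) c : {ae mu, forall x, P x} ->
  {ae mu, forall x, P (x + c)}.
Proof.
move=> [N [mN N0 PN]].
pose shift (x : measurableTypeR R) : measurableTypeR R := x + c.
have mshift : measurable_fun setT shift by exact: measurable_funD.
exists (shift @^-1` N); split=> [||x /= nPx]; last exact: PN.
  by rewrite -[X in measurable X]setTI; exact: mshift.
rewrite -N0; apply/esym/(@lebesgue_measure_unique R (pushforward mu shift)) => //.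
move=> _ [[a b] _ <-] /=; rewrite /pushforward.
have -> : shift @^-1` `]a, b]%classic = `](a - c), (b - c)]%classic.
  by apply/seteqP; split => x /=; rewrite !in_itv/= ltrBlDr lerBrDr.
rewrite !lebesgue_measure_itv/= !lte_fin ltrD2r; case: ifP => // _.
by rewrite -!EFinD; congr (_%:E); ring.
Qed.

(* [v] cannot cross the level [eta] upwards: after the last time at which
   [v <= eta] it would be nonincreasing. *)
Lemma dissipation_le v r S b p q eta : primitive v r p q -> primitive S b p q ->
  {ae mu, forall x, p <= x <= q -> 0 <= b x} ->
  {ae mu, forall x, p <= x <= q -> eta <= v x -> r x <= - b x} ->
  forall t, p <= t <= q -> v t <= Num.max eta (v p - (S t - S p)).
Proof.
move=> vr Sb b_ge0 rb t /andP[pt tq].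
have loss s : p <= s -> s <= t -> (forall x, s < x -> x <= t -> eta <= v x) ->
    v t <= v s - (S t - S s).
  move=> ps st above.
  have := primitive_le st (primitiveS ps tq vr) (primitiveS ps tq (primitiveZ (-1) Sb)).
  have /[swap]/[apply] : {ae mu, forall x, s <= x <= t -> r x <= -1 * b x}.
    apply: filterS2 rb (ae_neq s) => x rb xs /andP[sx xt].
    rewrite mulN1r rb ?(le_trans ps sx) ?(le_trans xt tq)// above//.
    by rewrite lt_neqAle eq_sym xs.
  lra.
rewrite le_max; have [//|/= etav] := leP (v t) eta.
have [[s /andP[ps st] vs]|] := pselect (exists2 s, p <= s <= t & v s <= eta).
  have vc := primitive_continuous (primitiveS ps tq vr) st.
  have [s' [ss' s't vs' above]] := last_exit st vc vs etav.
  have ps' := le_trans ps ss'.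
  have := loss s' ps' (ltW s't) (fun x sx xt => ltW (above x sx xt)).
  have := primitive_ae_ge0_nondecr Sb b_ge0 ps' (ltW s't) tq.
  lra.
move=> /forall2NP above; apply: (loss p (lexx p) pt _) => x px xt.
by case: (above x) => [[]|/negP]; [rewrite (ltW px)|rewrite -ltNge => /ltW].
Qed.

Lemma dissipation_norm_le v r S b p q eta : primitive v r p q -> primitive S b p q ->
  {ae mu, forall x, p <= x <= q -> 0 <= b x} -> 0 < eta ->
  {ae mu, forall x, p <= x <= q -> eta <= `|v x| -> Num.sg (v x) * r x <= - b x} ->
  forall t, p <= t <= q -> `|v t| <= Num.max eta (`|v p| - (S t - S p)).
Proof.
move=> vr Sb b0 eta0 rb t tpq.
have up : v t <= Num.max eta (v p - (S t - S p)).
  apply: (dissipation_le vr Sb b0) tpq; apply: filterS rb => x rb xpq vx.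
  have v0 := lt_le_trans eta0 vx.
  by have := rb xpq; rewrite gtr0_norm// gtr0_sg// mul1r; apply.
have down : -1 * v t <= Num.max eta (-1 * v p - (S t - S p)).
  apply: (dissipation_le (primitiveZ (-1) vr) Sb b0) tpq.
  apply: filterS rb => x rb xpq; rewrite !mulN1r => vx.
  have v0 : v x < 0 by rewrite -oppr_gt0 (lt_le_trans eta0).
  by have := rb xpq; rewrite ltr0_norm// ltr0_sg// mulN1r; apply.
have mono y : y <= `|v p| -> Num.max eta (y - (S t - S p)) <=
    Num.max eta (`|v p| - (S t - S p)).
  by move=> y_le; rewrite ge_max !le_max lexx/= lerD2r y_le orbT.
rewrite ler_norml lerNl -mulN1r (le_trans down)/= ?(le_trans up)// mono ?ler_norm//.
by rewrite mulN1r -normrN ler_norm.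
Qed.

End Primitives.

(** * The LuGre model *)

Section LimitBranch.
Variable R : realType.
Implicit Types (a rho Y t : R) (i j : nat).

Lemma ypieceE a g0 i rho Y t : ypiece a g0 i rho Y t =
  (-1) ^+ i * g0 + (Y - (-1) ^+ i * g0) * expR (- a * (t - rho)).
Proof.
rewrite /ypiece [a * _](_ : _ = - (- a * (t - rho))); last by ring.
by rewrite expRN; field; rewrite gt_eqF ?expR_gt0.
Qed.

Lemma ypiece_start a g0 i rho Y : ypiece a g0 i rho Y rho = Y.
Proof. by rewrite ypieceE subrr mulr0 expR0 mulr1 addrC subrK. Qed.

Lemma eq_ypiece a g0 i j rho rho' Y t t' : odd i = odd j -> t - rho = t' - rho' ->
  ypiece a g0 i rho Y t = ypiece a g0 j rho' Y t'.
Proof. by move=> ij tt'; rewrite !ypieceE tt' -signr_odd ij signr_odd. Qed.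

Lemma ypiece_bound a g0 i rho Y t : 0 <= a -> 0 <= g0 -> rho <= t ->
  `|ypiece a g0 i rho Y t| <= Num.max g0 `|Y|.
Proof.
move=> a_ge0 g0_ge0 rhot; rewrite ypieceE; set E := expR _.
have E_ge0 : 0 <= E := expR_ge0 _.
have subE_ge0 : 0 <= 1 - E.
  by rewrite subr_ge0 expR_le1 mulNr oppr_le0 mulr_ge0// subr_ge0.
have -> : (-1) ^+ i * g0 + (Y - (-1) ^+ i * g0) * E =
  (1 - E) * ((-1) ^+ i * g0) + E * Y by ring.
apply: le_trans (ler_normD _ _) _.
rewrite !normrM normr_sign mul1r.
rewrite (ger0_norm E_ge0) (ger0_norm subE_ge0) (ger0_norm g0_ge0).
set M := Num.max _ _; have -> : M = (1 - E) * M + E * M by ring.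
by rewrite lerD// ler_wpM2l// le_max lexx ?orbT.
Qed.

Lemma is_derive_ypiece a g0 i rho Y t : is_derive t 1 (ypiece a g0 i rho Y)
  (a * ((-1) ^+ i * g0 - ypiece a g0 i rho Y t)).
Proof.
rewrite (_ : ypiece a g0 i rho Y = cst ((-1) ^+ i * g0) +
    (Y - (-1) ^+ i * g0) \*: (expR \o (fun s => - a * (s - rho)))); last first.
  by apply/funext => s; exact: ypieceE.
by apply: is_derive_eq; rewrite /GRing.scale/= fctE/= /GRing.scale/=; ring.
Qed.

Lemma continuous_ypiece a g0 i rho Y : continuous (ypiece a g0 i rho Y).
Proof.
move=> t; have [+ _] := is_derive_ypiece a g0 i rho Y t.
by move=> /derivable1_diffP/differentiable_continuous.
Qed.

End LimitBranch.

Section LuGre.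
Variable R : realType.
Local Notation mu := (@lebesgue_measure R).
Variables (s0 : R) (g u du : R -> R).
Hypotheses (s0_gt0 : 0 < s0) (g_gt0 : forall th, 0 < g th).
Hypothesis uW : W1inf_with_deriv u du.
Implicit Types (p q t Y gamma theta W : R) (z w : R -> R) (n : nat).

Local Notation a := (s0 / g 0).

Definition cumulative_variation (t : R) : R := \int[mu]_(s in `[0, t]) `|du s|.

Local Notation V := cumulative_variation.

Lemma cumulative_variation0 : V 0 = 0.
Proof. by rewrite /cumulative_variation set_itv1 Rintegral_set1. Qed.

Lemma primitive_input p q : 0 <= p -> p <= q -> primitive u du p q.
Proof. by have [_ _ _ uE] := uW => p0; exact: primitive_halfline uE. Qed.

Lemma primitive_variation p q : 0 <= p -> p <= q ->
  primitive V (fun t => `|du t|) p q.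
Proof.
move=> p0; apply: (primitive_halfline (c := 0)) => // t t0.
have [_ _ _ /(_ t t0)[dui _]] := uW.
by rewrite add0r; split=> //; exact: integrable_norm dui.
Qed.

Lemma variation_nondecr p q : 0 <= p -> nondecr_on V p q.
Proof.
move=> p0 x y px xy yq.
have Vp := primitive_variation p0 (le_trans px (le_trans xy yq)).
by apply: (primitive_ae_ge0_nondecr Vp) => //; exact: aeW.
Qed.

Section MonotoneInput.
Variables (n : nat) (p q : R).
Hypotheses (p_ge0 : 0 <= p) (le_pq : p <= q).
Hypothesis umono : nondecr_on (fun t => (-1) ^+ n * u t) p q.

Lemma monotone_rate_norm :
  {ae mu, forall t, p <= t <= q -> `|du t| = (-1) ^+ n * du t}.
Proof.
have := primitive_nondecr_ae_ge0 (primitiveZ _ (primitive_input p_ge0 le_pq)) umono.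
apply: filterS => t du0 /du0 /ger0_norm <-.
by rewrite normrM normr_sign mul1r.
Qed.

Lemma variation_monotone s t : p <= s -> s <= t -> t <= q ->
  V t - V s = (-1) ^+ n * (u t - u s).
Proof.
move=> ps st tq.
have [edui eduE] := primitiveZ ((-1) ^+ n) (primitive_input p_ge0 le_pq).
have Vp := primitive_variation p_ge0 le_pq.
have [_ ->//] := eq_ae_primitive edui monotone_rate_norm Vp.
by rewrite mulrBr -eduE.
Qed.

(* With a constant friction level [lugre_rhs] does not depend on [gamma]: it is
   the right-hand side of the limit equation. *)
Lemma limit_piece_solution gamma Y :
  let w t := s0^-1 * ypiece a (g 0) n (V p) Y (V t) in
  primitive w (lugre_rhs s0 (fun=> g 0) du gamma w) p q.
Proof.
move=> w; pose y := ypiece a (g 0) n (V p) Y.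
have [s0_neq0 g_neq0] : s0 != 0 /\ g 0 != 0 by rewrite !gt_eqF.
have [dui _] := primitive_input p_ge0 le_pq.
have Vp := primitive_variation p_ge0 le_pq.
have dyc : continuous (fun t => a * ((-1) ^+ n * g 0 - y t)).
  move=> t; apply: cvgM; first exact: cvg_cst.
  by apply: cvgB; [exact: cvg_cst | exact: continuous_ypiece].
have wp := primitiveZ s0^-1
  (primitive_comp (is_derive_ypiece a (g 0) n (V p) Y) dyc le_pq Vp).
apply: eq_ae_primitive (wp).
  have awc := primitive_continuous (primitiveZ (- a) wp) le_pq.
  have wdui := integrable_itv_continuousM awc Vp.1.
  rewrite (_ : lugre_rhs _ _ _ _ _ =
    fun t => - a * w t * `|du t| + du t); last first.
    by apply/funext => t; rewrite /lugre_rhs; ring.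
  exact: (@integrableD _ _ _ mu _ _
    (EFin \o (fun t => - a * w t * `|du t|)) (EFin \o du)).
apply: filterS monotone_rate_norm => t du_norm /du_norm duE.
have signE : du t = (-1) ^+ n * `|du t| by rewrite duE signrMK.
rewrite /lugre_rhs [X in _ = _ + X]signE /w -/y; field.
by rewrite s0_neq0 g_neq0.
Qed.

End MonotoneInput.

(* With [G := g (du t / gamma)] and [v := z - w], the error obeys
   [v' = - (s0 * |du| / G) * (v - (G - g 0) / g 0 * w)]. *)
Lemma lugre_drift gamma theta W z w t :
  `|g (du t / gamma) - g 0| <= theta * g 0 -> theta <= 1 -> `|w t| <= W ->
  2 * (theta * W) <= `|z t - w t| ->
  Num.sg (z t - w t) * (lugre_rhs s0 g du gamma z t -
                        lugre_rhs s0 (fun=> g 0) du gamma w t) <=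
    - (theta * W * (a / 2) * `|du t|).
Proof.
move=> gG theta1 wW vW; have g0 := g_gt0 0.
rewrite /lugre_rhs; move: (g_gt0 (du t / gamma)) gG; set G := g _ => G0 gG.
pose v := z t - w t; pose k := s0 * `|du t| / G.
have k0 : 0 <= k by rewrite divr_ge0 ?mulr_ge0// ltW.
have thetaW0 : 0 <= theta * W.
  have theta0 : 0 <= theta by rewrite -(pmulr_lge0 _ g0) (le_trans _ gG).
  by rewrite mulr_ge0// (le_trans _ wW).
have [G_neq0 g_neq0] : G != 0 /\ g 0 != 0 by rewrite !gt_eqF.
rewrite [X in _ * X <= _](_ : _ = - k * (v - (G - g 0) / g 0 * w t)); last first.
  by rewrite /k /v; field; rewrite G_neq0 g_neq0.
rewrite mulrCA mulrBr -normrEsg.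
have rel : Num.sg v * ((G - g 0) / g 0 * w t) <= theta * W.
  apply: le_trans (ler_norm _) _; rewrite !normrM normrV ?unitfE//.
  rewrite -[leRHS]mul1r ler_pM ?mulr_ge0//.
    by rewrite normr_sg lern1 leq_b1.
  by rewrite ler_pM ?mulr_ge0 ?invr_ge0// (gtr0_norm g0) ler_pdivrMr.
have rate : a / 2 * `|du t| <= k.
  have -> : a / 2 * `|du t| = s0 * `|du t| / (2 * g 0) by field.
  rewrite /k ler_wpM2l ?mulr_ge0 ?(ltW s0_gt0)// lef_pV2 ?posrE ?mulr_gt0//.
  have := ler_norm (G - g 0); have : theta * g 0 <= g 0 by rewrite ger_pMl.
  lra.
have vrel : theta * W <= `|v| - Num.sg v * ((G - g 0) / g 0 * w t) by rewrite /v; lra.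
rewrite mulNr lerN2 [leRHS]mulrC -[leLHS]mulrA ler_pM//.
by rewrite mulr_ge0// !divr_ge0// ltW.
Qed.

Lemma lugre_contraction gamma theta W z w p q : 0 <= p -> p <= q ->
  primitive z (lugre_rhs s0 g du gamma z) p q ->
  primitive w (lugre_rhs s0 (fun=> g 0) du gamma w) p q ->
  {ae mu, forall t, p <= t <= q -> `|g (du t / gamma) - g 0| <= theta * g 0} ->
  0 < theta <= 1 -> 0 < W -> (forall t, p <= t <= q -> `|w t| <= W) ->
  forall t, p <= t <= q ->
  `|z t - w t| <= Num.max (2 * (theta * W))
    (`|z p - w p| - theta * W * (a / 2) * (V t - V p)).
Proof.
move=> p0 pq zr wr gae /andP[theta0 theta1] W0 wW t tpq; rewrite mulrBr.
have rate_ge0 : 0 <= theta * W * (a / 2).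
  by rewrite !mulr_ge0 ?invr_ge0// ltW.
apply: (dissipation_norm_le (primitiveB zr wr)
  (primitiveZ _ (primitive_variation p0 pq))) tpq.
- by apply: aeW => x _; rewrite mulr_ge0.
- by rewrite !mulr_gt0.
- by apply: filterS gae => x gx xpq; apply: lugre_drift => //; [exact: gx|exact: wW].
Qed.

Lemma lugre_tracking gamma theta W z (w : nat -> R -> R) (P : nat -> R) :
  0 <= P 0%N -> (forall n, P n <= P n.+1) ->
  (forall n, primitive z (lugre_rhs s0 g du gamma z) (P n) (P n.+1)) ->
  (forall n,
    primitive (w n) (lugre_rhs s0 (fun=> g 0) du gamma (w n)) (P n) (P n.+1)) ->
  (forall n, w n (P n.+1) = w n.+1 (P n.+1)) ->
  {ae mu, forall t, 0 <= t -> `|g (du t / gamma) - g 0| <= theta * g 0} ->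
  0 < theta <= 1 -> 0 < W -> (forall n t, P n <= t <= P n.+1 -> `|w n t| <= W) ->
  forall n t, P n <= t <= P n.+1 ->
  `|z t - w n t| <= Num.max (2 * (theta * W))
    (`|z (P 0%N) - w 0%N (P 0%N)| -
     theta * W * (a / 2) * (V t - V (P 0%N))).
Proof.
move=> P0 PS zr wr joint gae theta01 W0 wW.
have Pge0 n : 0 <= P n by elim: n => // n /le_trans; apply.
set K := theta * W * (a / 2); set eta := 2 * (theta * W).
set err0 := `|z (P 0%N) - _|.
have gaen n : {ae mu, forall t, P n <= t <= P n.+1 ->
    `|g (du t / gamma) - g 0| <= theta * g 0}.
  by apply: filterS gae => t gt /andP[Pt _]; apply/gt/le_trans/Pt.
have step n : `|z (P n) - w n (P n)| <=
      Num.max eta (err0 - K * (V (P n) - V (P 0%N))) ->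
    forall t, P n <= t <= P n.+1 -> `|z t - w n t| <=
      Num.max eta (err0 - K * (V t - V (P 0%N))).
  move=> node t tP.
  have K0 : 0 <= K by case/andP: theta01 => theta0 _; rewrite !mulr_ge0 ?invr_ge0// ltW.
  have KV : 0 <= K * (V t - V (P n)).
    case/andP: tP => Pt _; rewrite mulr_ge0// subr_ge0.
    exact: (@variation_nondecr (P n) t).
  apply: le_trans (lugre_contraction (Pge0 n) (PS n) (zr n) (wr n) (gaen n)
    theta01 W0 (wW n) tP) _.
  rewrite -/K -/eta ge_max le_max lexx/= lerBlDr (le_trans node)// ge_max.
  rewrite -!lerBlDr le_max; apply/andP; split; rewrite ?le_max; apply/orP.
    by left; lra.
  by right; rewrite !mulrBr; lra.
move=> n; apply: (step); elim: n => [|n IHn].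
  by rewrite subrr mulr0 subr0 le_max lexx orbT.
by rewrite -joint; apply: step IHn _ _; rewrite PS lexx.
Qed.

Lemma slow_input_cvg (h : R -> R) : continuous h ->
  Linf_cvg_gamma (fun gamma t => h (du t / gamma)) (fun=> h 0).
Proof.
move=> hc e e0; have [_ [M duM] _ _] := uW.
have /cvgrPdist_le/(_ _ e0)/nbhs_ballP[d /= d0 hd] := hc 0.
exists ((`|M| + 1) / d) => gamma; rewrite ler_pdivrMr// => Mgamma gamma0.
apply: filterS duM => t duM t0; rewrite distrC; apply: hd.
rewrite /ball/= sub0r normrN normrM normfV (gtr0_norm gamma0) ltr_pdivrMr// mulrC.
apply: le_lt_trans (duM t0) _; apply: lt_le_trans Mgamma.
by rewrite (le_lt_trans (ler_norm M))// ltrDl.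
Qed.

Lemma lugre_rhs_bound gamma M Z z t : `|du t| <= M -> `|z t| <= Z ->
  g 0 / 2 <= g (du t / gamma) ->
  `|lugre_rhs s0 g du gamma z t| <= s0 * M / (g 0 / 2) * Z + M.
Proof.
move=> duM zZ gt; have g2_gt0 : 0 < g 0 / 2 by rewrite divr_gt0.
apply: le_trans (ler_normD _ _) _; rewrite lerD//.
have [s0_ge0 G_gt0] := (ltW s0_gt0, g_gt0 (du t / gamma)).
rewrite !normrM normrV ?unitfE ?gt_eqF// normrN normr_id.
rewrite (ger0_norm s0_ge0) (gtr0_norm G_gt0).
by rewrite !ler_pM ?mulr_ge0 ?invr_ge0 ?(ltW G_gt0)// lef_pV2 ?posrE.
Qed.

Lemma lugre_output_approx s1 f Z e : continuous g -> continuous f -> f 0 = 0 ->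
  0 <= s1 -> 0 < e -> exists G, forall gamma, G <= gamma -> 0 < gamma -> forall z,
  {ae mu, forall t, 0 <= t -> `|z t| <= Z ->
     `|lugre_output s0 s1 g f du gamma z t - s0 * z t| <= e}.
Proof.
move=> gc fc f0 s1_ge0 e0; have g0 := g_gt0 0.
have [_ [M duM] _ _] := uW.
have [e2_gt0 g2_gt0] : 0 < e / 2 /\ 0 < g 0 / 2 by rewrite !divr_gt0.
have [Gf fG] := slow_input_cvg fc e2_gt0.
have [Gg gG] := slow_input_cvg gc g2_gt0.
pose X := s0 * M / (g 0 / 2) * Z + M.
exists (Num.max Gf (Num.max Gg (s1 * X / (e / 2)))) => gamma.
rewrite !ge_max => /and3P[Gfg Ggg XG] gamma0 z.
apply: filterS3 duM (fG gamma Gfg gamma0) (gG gamma Ggg gamma0).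
move=> t duM /[swap] gt ft t0 zZ.
have {}ft := ft t0; rewrite f0 subr0 in ft.
have rhsX : `|lugre_rhs s0 g du gamma z t| <= X.
  apply: lugre_rhs_bound => //; first exact: duM.
  by have := gt t0; rewrite ler_norml; lra.
rewrite /lugre_output (_ : _ - _ = s1 / gamma * lugre_rhs s0 g du gamma z t +
  f (du t / gamma)); last by ring.
apply: le_trans (ler_normD _ _) _; rewrite [e]splitr lerD//.
rewrite normrM ger0_norm ?divr_ge0 ?(ltW gamma0)// mulrAC ler_pdivrMr//.
rewrite [leRHS]mulrC; move: XG; rewrite ler_pdivrMr//; apply: le_trans.
by rewrite ler_wpM2l.
Qed.

Section AlternatingInput.
Variables (P Y : nat -> R) (m : R).
Hypotheses (P0 : P 0%N = 0) (PS : forall n, P n <= P n.+1).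
Hypothesis umono : forall n, nondecr_on (fun t => (-1) ^+ n * u t) (P n) (P n.+1).
Hypothesis m_gt0 : 0 < m.
Hypothesis variation_step : forall n, m <= V (P n.+1) - V (P n).

Definition limit_output n t : R :=
  ypiece a (g 0) n (V (P n)) (Y n) (V t).

Hypothesis YS : forall n, Y n.+1 = limit_output n (P n.+1).

Local Notation bound := (Num.max (g 0) `|Y 0%N|).

Lemma switch_ge0 n : 0 <= P n.
Proof. by elim: n => [|n /le_trans]; rewrite ?P0//; apply. Qed.

Lemma limit_output_bound n t : P n <= t -> `|limit_output n t| <= bound.
Proof.
have a_ge0 : 0 <= a by rewrite divr_ge0// ltW.
have piece k s : P k <= s -> `|limit_output k s| <= Num.max (g 0) `|Y k|.
  move=> Pks; apply: ypiece_bound => //; first exact: ltW.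
  exact: (variation_nondecr (switch_ge0 k) (lexx _) Pks (lexx s)).
have node k : `|Y k| <= bound.
  elim: k => [|k IHk]; first by rewrite le_max lexx orbT.
  by rewrite YS (le_trans (piece k _ (PS k)))// ge_max le_max lexx.
by move=> /piece/le_trans; apply; rewrite ge_max le_max lexx node.
Qed.

Lemma variation_switch_ge n : n%:R * m <= V (P n).
Proof.
elim: n => [|n IHn]; first by rewrite mul0r P0 cumulative_variation0.
by rewrite -natr1 mulrDl mul1r; have := variation_step n; lra.
Qed.

Lemma state_error gamma theta x0 z : caratheodory_sol s0 g du gamma x0 z ->
  {ae mu, forall t, 0 <= t -> `|g (du t / gamma) - g 0| <= theta * g 0} ->
  0 < theta <= 1 -> forall n t, P n <= t <= P n.+1 ->
  `|s0 * z t - limit_output n t| <= Num.max (2 * (theta * bound))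
    (`|s0 * x0 - Y 0%N| - theta * bound * (a / 2) * V t).
Proof.
move=> zE gae theta01 n t tP; have s0_ge0 := ltW s0_gt0.
have s0_neq0 : s0 != 0 by rewrite gt_eqF.
have bound_gt0 : 0 < bound by rewrite lt_max g_gt0.
pose w k s := s0^-1 * limit_output k s.
have scale y k s : `|s0 * y - limit_output k s| = s0 * `|y - w k s|.
  by rewrite -{2}(ger0_norm s0_ge0) -normrM mulrBr mulVKf.
have z0 : z 0 = x0 by rewrite (zE 0 _).2// set_itv1 Rintegral_set1 addr0.
have err0E : `|s0 * x0 - Y 0%N| = s0 * `|x0 - w 0%N 0|.
  by rewrite -scale /limit_output P0 ypiece_start.
have wsol k : primitive (w k) (lugre_rhs s0 (fun=> g 0) du gamma (w k)) (P k) (P k.+1).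
  exact: limit_piece_solution (switch_ge0 k) (PS k) (@umono k) gamma (Y k).
have zsol k : primitive z (lugre_rhs s0 g du gamma z) (P k) (P k.+1).
  exact: (primitive_halfline (switch_ge0 k) zE (PS k)).
have joint k : w k (P k.+1) = w k.+1 (P k.+1).
  by rewrite /w -YS /limit_output ypiece_start.
have W0 : 0 < s0^-1 * bound by rewrite mulr_gt0 ?invr_gt0.
have wW k s : P k <= s <= P k.+1 -> `|w k s| <= s0^-1 * bound.
  move=> /andP[/limit_output_bound wb _].
  by rewrite normrM (ger0_norm (_ : 0 <= s0^-1)) ?invr_ge0// ler_wpM2l ?invr_ge0.
have P0_ge0 : 0 <= P 0%N by rewrite P0.
have := lugre_tracking P0_ge0 PS zsol wsol joint gae theta01 W0 wW tP.
rewrite P0 z0 cumulative_variation0 subr0 -(ler_pM2l s0_gt0) scale err0E.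
move=> /le_trans; apply; rewrite maxr_pMr//.
have -> : s0 * (2 * (theta * (s0^-1 * bound))) = 2 * (theta * bound).
  by field.
suff -> : s0 * (`|x0 - w 0%N 0| - theta * (s0^-1 * bound) * (a / 2) * V t) =
    s0 * `|x0 - w 0%N 0| - theta * bound * (a / 2) * V t by [].
by field; rewrite s0_neq0 gt_eqF.
Qed.

Lemma state_tracking x0 (z : R -> R -> R) (e : R) : continuous g ->
  (forall gamma, 0 < gamma -> caratheodory_sol s0 g du gamma x0 (z gamma)) ->
  0 < e -> exists G N, forall gamma, G <= gamma -> 0 < gamma ->
  forall n t, (N <= n)%N -> P n <= t <= P n.+1 ->
  `|s0 * z gamma t - limit_output n t| <= e.
Proof.
move=> gc zsol e0; have g0 := g_gt0 0.
have bound_gt0 : 0 < bound by rewrite lt_max g0.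
pose theta := Num.min 1 (e / (2 * bound)).
have theta01 : 0 < theta <= 1 by rewrite lt_min ltr01 ge_min lexx divr_gt0 ?mulr_gt0.
have [theta0 _] := andP theta01.
have radius_le : 2 * (theta * bound) <= e.
  by rewrite mulrCA -ler_pdivlMr ?mulr_gt0// ge_min lexx orbT.
have [G gG] := slow_input_cvg gc (mulr_gt0 theta0 g0).
pose err0 := `|s0 * x0 - Y 0%N|; pose K := theta * bound * (a / 2).
have K0 : 0 < K by rewrite mulr_gt0 ?(mulr_gt0 theta0)// !divr_gt0.
exists G, (Num.truncn (err0 / (K * m))).+1 => gamma Ggamma gamma0 n t Nn tP.
have := state_error (zsol gamma gamma0) (gG gamma Ggamma gamma0) theta01 tP.
move=> /le_trans; apply; rewrite ge_max radius_le/= (le_trans _ (ltW e0))// subr_le0.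
have := truncnS_gt (err0 / (K * m)).
rewrite (ltr_pdivrMr _ _ (mulr_gt0 K0 m_gt0)) => /ltW/le_trans; apply.
rewrite mulrCA ler_wpM2l ?(ltW K0)//.
apply: (@le_trans _ _ (n%:R * m)); first by rewrite ler_wpM2r ?(ltW m_gt0)// ler_nat.
apply: le_trans (variation_switch_ge n) _; have /andP[Pt _] := tP.
exact: variation_nondecr (switch_ge0 n) _ _ (lexx _) Pt (lexx t).
Qed.

Lemma output_tracking s1 f x0 (z : R -> R -> R) (e : R) : 0 <= s1 -> continuous g ->
  continuous f -> f 0 = 0 ->
  (forall gamma, 0 < gamma -> caratheodory_sol s0 g du gamma x0 (z gamma)) ->
  0 < e -> exists G N, forall gamma, G <= gamma -> 0 < gamma ->
  forall n, (N <= n)%N -> {ae mu, forall t, P n <= t <= P n.+1 ->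
    `|lugre_output s0 s1 g f du gamma (z gamma) t - limit_output n t| <= e}.
Proof.
move=> s1_ge0 gc fc f0 zsol e0; have e2_gt0 : 0 < e / 2 by rewrite divr_gt0.
have [Gs [N state]] := state_tracking gc zsol e2_gt0.
have [Go output] := lugre_output_approx ((e / 2 + bound) / s0) gc fc f0 s1_ge0 e2_gt0.
exists (Num.max Gs Go), N => gamma; rewrite ge_max => /andP[Gsg Gog] gamma0 n Nn.
apply: filterS (output gamma Gog gamma0 (z gamma)) => t + tP.
have [Pt _] := andP tP; have t0 := le_trans (switch_ge0 n) Pt.
have zlim := state gamma Gsg gamma0 n t Nn tP.
have /[swap]/(_ t0)/[apply] : `|z gamma t| <= (e / 2 + bound) / s0.
  rewrite ler_pdivlMr// mulrC -{1}(gtr0_norm s0_gt0) -normrM.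
  rewrite -[s0 * _](subrK (limit_output n t)) (le_trans (ler_normD _ _))// lerD//.
  exact: limit_output_bound.
move=> out; rewrite -[_ - _](subrKA (s0 * z gamma t)) [e]splitr.
by rewrite (le_trans (ler_normD _ _))// lerD.
Qed.

End AlternatingInput.

End LuGre.

(** * Periodic inputs *)

Section PeriodicInput.
Variable R : realType.
Local Notation mu := (@lebesgue_measure R).

Lemma periodic_limit_eq (y : R -> R -> R) (ystar yo phi : R -> R) (T p q : R) :
  Linf_cvg_gamma y ystar -> Linf_cvg_periods ystar T yo -> 0 <= p -> p < q -> q <= T ->
  {within `[p, q], continuous yo} -> {within `[p, q], continuous phi} ->
  (forall e : R, 0 < e -> exists G K, forall gamma, G <= gamma -> 0 < gamma ->
    forall k, (K <= k)%N ->
    {ae mu, forall t, p <= t <= q -> `|y gamma (t + k%:R * T) - phi t| <= e}) ->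
  forall t, p <= t <= q -> yo t = phi t.
Proof.
move=> yg yk p0 pq qT yoc phic close t tpq.
apply/eqP; rewrite -subr_eq0 -normr_le0; apply/ler_addgt0Pr => e e0; rewrite add0r.
have e3_gt0 : 0 < e / 3 by rewrite divr_gt0.
have [G1 [K1 yphi]] := close _ e3_gt0.
have [G2 ystar_close] := yg _ e3_gt0.
have [K2 yo_close] := yk _ e3_gt0.
pose k := maxn K1 K2; pose gamma := Num.max 1 (Num.max G1 G2).
have gamma0 : 0 < gamma by rewrite lt_max ltr01.
have [G1gamma G2gamma] : G1 <= gamma /\ G2 <= gamma by rewrite !le_max !lexx !orbT.
have dist_c : {within `[p, q], continuous (fun s => `|yo s - phi s|)}.
  by move=> s; apply: cvg_norm; exact: within_continuousB yoc phic s.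
apply: (ae_le_continuous pq dist_c) tpq.
apply: filterS3 (yphi gamma G1gamma gamma0 k (leq_maxl _ _))
  (ae_addr (k%:R * T) (ystar_close gamma G2gamma gamma0))
  (yo_close k (leq_maxr _ _)) => s yphi_s ystar_s yo_s /[dup] spq /andP[ps sq].
have kT0 : 0 <= k%:R * T by rewrite mulr_ge0// (le_trans p0)// (le_trans (ltW pq)).
have {}yphi_s := yphi_s spq.
have {}ystar_s := ystar_s (addr_ge0 (le_trans p0 ps) kT0).
have {}yo_s : `|ystar (s + k%:R * T) - yo s| <= e / 3 by apply: yo_s; lra.
move: yphi_s ystar_s yo_s; rewrite !ler_norml; lra.
Qed.

Section PeriodicSwitching.
Variables (N : nat) (T : R) (q : nat -> R).
Hypotheses (N_gt0 : (0 < N)%N) (q0 : q 0%N = 0) (qN : q N = T).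

(* [q] lists the switching times of one period, [switch_time] those of all periods. *)
Definition switch_time (n : nat) : R := q (n %% N) + (n %/ N)%:R * T.

Lemma modnS_dvd n : (N %| n.+1)%N -> (n %% N).+1 = N.
Proof.
move=> Nn; apply/eqP; rewrite eqn_leq ltn_pmod//= dvdn_leq//.
by rewrite -addn1 /dvdn modnDml addn1.
Qed.

Lemma periodic_modnS (X : Type) (h : nat -> X) n : h N = h 0%N ->
  h (n.+1 %% N)%N = h (n %% N).+1.
Proof. by move=> hN; rewrite modnS; case: ifPn => // /modnS_dvd ->. Qed.

Lemma switch_timeS n : switch_time n.+1 = q (n %% N).+1 + (n %/ N)%:R * T.
Proof.
rewrite /switch_time divnS// modnS; case: ifPn => [/modnS_dvd ->|_].
  by rewrite q0 qN add1n -natr1; ring.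
by rewrite add0n.
Qed.

End PeriodicSwitching.

Section AlternatingPeriodicInput.
Variables (s0 : R) (g u du : R -> R) (N : nat) (T m : R) (q Y : nat -> R).
Hypotheses (s0_gt0 : 0 < s0) (g_gt0 : forall th, 0 < g th).
Hypothesis uW : W1inf_with_deriv u du.
Hypothesis u_periodic : forall t : R, 0 <= t -> u (t + T) = u t.
Hypotheses (N_gt0 : (0 < N)%N) (N_even : ~~ odd N).
Hypotheses (q0 : q 0%N = 0) (qN : q N = T).
Hypothesis q_incr : forall i, (i < N)%N -> q i < q i.+1.
Hypothesis umono :
  forall i, (i < N)%N -> nondecr_on (fun t => (-1) ^+ i * u t) (q i) (q i.+1).

Local Notation V := (cumulative_variation du).
Local Notation P := (switch_time N T q).

Hypothesis m_gt0 : 0 < m.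
Hypothesis variation_ge : forall i, (i < N)%N -> m <= V (q i.+1) - V (q i).
Hypothesis YS :
  forall i, (i < N)%N -> Y i.+1 = limit_output s0 g du q Y i (q i.+1).
Hypothesis YN : Y N = Y 0%N.

Lemma base_switch_le i j : (i <= j)%N -> (j <= N)%N -> q i <= q j.
Proof.
move=> ij jN; have iN := leq_trans ij jN.
have Dconvex : {in [pred k | (k <= N)%N] &,
    forall i j k : nat, (i < k < j)%N -> k \in [pred k | (k <= N)%N]}.
  by move=> i1 j1 _ /= j1N k /andP[_ kj]; exact: leq_trans (ltnW kj) j1N.
by apply: (homo_leq_in lexx le_trans Dconvex) => // k kN kSN; exact/ltW/q_incr.
Qed.

Lemma period_ge0 : 0 <= T.
Proof. by rewrite -qN -q0 base_switch_le. Qed.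

Lemma base_switch_ge0 i : (i <= N)%N -> 0 <= q i.
Proof. by move=> iN; rewrite -q0 base_switch_le. Qed.

Lemma switch_time_le n : P n <= P n.+1.
Proof. by rewrite switch_timeS// lerD2r ltW// q_incr// ltn_pmod. Qed.

Lemma input_shift k t : 0 <= t -> u (t + k%:R * T) = u t.
Proof.
move=> t0; elim: k => [|k IHk]; first by rewrite mul0r addr0.
rewrite -natr1 mulrDl mul1r addrA u_periodic//.
by rewrite addr_ge0// mulr_ge0// period_ge0.
Qed.

Lemma sign_modn n : (-1) ^+ (n %% N) = (-1) ^+ n :> R.
Proof. by rewrite -signr_odd odd_mod ?signr_odd//; exact: negbTE. Qed.

Lemma input_switch_nondecr n :
  nondecr_on (fun t => (-1) ^+ n * u t) (P n) (P n.+1).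
Proof.
rewrite switch_timeS// /switch_time => x y.
set i := (n %% N)%N; set k := (n %/ N)%:R * T => qx xy yq.
have iN : (i < N)%N := ltn_pmod n N_gt0.
have qi0 := base_switch_ge0 (ltnW iN).
rewrite -(subrK k x) -(subrK k y) !input_shift ?subr_ge0; [|lra..].
by rewrite -sign_modn -/i; apply: umono => //; lra.
Qed.

Lemma variation_shift n t : q (n %% N) <= t <= q (n %% N).+1 ->
  V (t + (n %/ N)%:R * T) - V (P n) = V t - V (q (n %% N)).
Proof.
set i := (n %% N)%N; move=> /andP[qt tq].
have iN : (i < N)%N := ltn_pmod n N_gt0.
have qi0 := base_switch_ge0 (ltnW iN); have t0 := le_trans qi0 qt.
have P0 : 0 <= P n by rewrite addr_ge0// mulr_ge0// period_ge0.
rewrite (variation_monotone uW P0 (switch_time_le n) (@input_switch_nondecr n)) //.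
- rewrite (variation_monotone uW qi0 (ltW (q_incr iN)) (umono iN))//.
  by rewrite sign_modn !input_shift.
- by rewrite /switch_time lerD2r.
- by rewrite switch_timeS// lerD2r.
Qed.

Lemma variation_shiftS n :
  V (P n.+1) - V (P n) = V (q (n %% N).+1) - V (q (n %% N)).
Proof.
by rewrite switch_timeS// variation_shift// lexx andbT ltW// q_incr// ltn_pmod.
Qed.

Lemma periodic_limit s1 f x0 (z : R -> R -> R) (ystar yo : R -> R) :
  0 <= s1 -> continuous g -> continuous f -> f 0 = 0 ->
  (forall gamma, 0 < gamma -> caratheodory_sol s0 g du gamma x0 (z gamma)) ->
  Linf_cvg_gamma (fun gamma => lugre_output s0 s1 g f du gamma (z gamma)) ystar ->
  Linf_cvg_periods ystar T yo -> {within `[0, T], continuous yo} ->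
  forall i t, (i < N)%N -> q i <= t <= q i.+1 ->
  yo t = limit_output s0 g du q Y i t.
Proof.
move=> s1_ge0 gc fc f0 zsol yg yk yoc i t iN tq.
have [qi0 qi_lt qiT] : [/\ 0 <= q i, q i < q i.+1 & q i.+1 <= T].
  by rewrite base_switch_ge0 ?(ltnW iN)// q_incr// -qN base_switch_le.
have limc : {within `[q i, q i.+1], continuous (limit_output s0 g du q Y i)}.
  have Vc := primitive_continuous (primitive_variation uW qi0 (ltW qi_lt)) (ltW qi_lt).
  by apply: within_continuous_comp Vc => x _; exact: continuous_ypiece.
apply: (periodic_limit_eq yg yk qi0 qi_lt qiT _ limc) tq.
  exact: within_itv_continuousS qi0 qiT yoc.
move=> e e0.
have P0 : P 0%N = 0 by rewrite /switch_time mod0n div0n mul0r addr0.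
pose Yper n := Y (n %% N)%N.
have YperS n : Yper n.+1 = limit_output s0 g du P Yper n (P n.+1).
  rewrite /limit_output /Yper (periodic_modnS N_gt0 _ YN) YS; last exact: ltn_pmod.
  have odd_n : odd (n %% N) = odd n by rewrite odd_mod//; exact: negbTE.
  exact: (eq_ypiece _ _ _ odd_n (esym (variation_shiftS n))).
have PV n : m <= V (P n.+1) - V (P n).
  by rewrite variation_shiftS variation_ge ?ltn_pmod.
have [G [M track]] := output_tracking s0_gt0 g_gt0 uW P0 switch_time_le
  input_switch_nondecr m_gt0 PV YperS s1_ge0 gc fc f0 zsol e0.
exists G, M => gamma Ggamma gamma0 k Mk.
pose n := (k * N + i)%N.
have nmod : (n %% N = i)%N by rewrite /n modnMDl modn_small.
have ndiv : (n %/ N = k)%N by rewrite /n divnMDl// divn_small// addn0.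
have Mn : (M <= n)%N.
  by rewrite (leq_trans Mk)// (leq_trans (leq_pmulr k N_gt0))// leq_addr.
have odd_n : odd n = odd i by rewrite -nmod odd_mod//; exact: negbTE.
apply: filterS (ae_addr (k%:R * T) (track gamma Ggamma gamma0 n Mn)) => s + sq.
rewrite switch_timeS// {1}/switch_time nmod ndiv !lerD2r => /(_ sq).
suff -> : limit_output s0 g du P Yper n (s + k%:R * T) = limit_output s0 g du q Y i s.
  by [].
rewrite /limit_output /Yper nmod.
have := @variation_shift n s; rewrite nmod ndiv => /(_ sq); exact: eq_ypiece.
Qed.

End AlternatingPeriodicInput.
End PeriodicInput.

(** * Bimodal inputs *)

Section BimodalLoop.
Variable R : realType.
Implicit Types (a s t : R) (i : nat).

Lemma piecewise_if (X : Type) (F : nat -> R -> X) (r : nat -> R) i s :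
  r 1%N < r 2%N -> r 2%N < r 3%N ->
  (forall j, (j < 3)%N -> F j (r j.+1) = F j.+1 (r j.+1)) ->
  (i < 4)%N -> r i <= s <= r i.+1 ->
  (if s <= r 1%N then F 0%N s else if s <= r 2%N then F 1%N s
   else if s <= r 3%N then F 2%N s else F 3%N s) = F i s.
Proof.
move=> r12 r23 Fjoint; have r13 := lt_trans r12 r23.
have right_end j : (j < 3)%N -> s <= r j.+1 -> r j.+1 <= s -> F j s = F j.+1 s.
  by move=> j3 sr rs; rewrite (le_anti (_ : s <= r j.+1 <= s)) ?sr// Fjoint.
case: i => [|[|[|[|//]]]] _ /andP[rs sr]; rewrite ?sr//.
- by case: ifP => // sr1; exact: right_end.
- rewrite leNgt (lt_le_trans r12 rs)/=.
  by case: ifP => // sr2; exact: right_end.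
- rewrite !leNgt (lt_le_trans r13 rs) (lt_le_trans r23 rs)/= -leNgt.
  by case: ifP => // sr3; exact: right_end.
Qed.

Variables (umin1 umax1 umin2 umax2 : R).

Definition bimodal_level : nat -> R := nth 0 [:: umin1; umax1; umin2; umax2; umin1].

Definition bimodal_rho : nat -> R :=
  nth 0 [:: 0; rho1 umin1 umax1 umin2 umax2; rho2 umin1 umax1 umin2 umax2;
            rho3 umin1 umax1 umin2 umax2; rho4 umin1 umax1 umin2 umax2].

Lemma bimodal_rhoS i : (i < 4)%N -> bimodal_rho i.+1 =
  bimodal_rho i + (-1) ^+ i * (bimodal_level i.+1 - bimodal_level i).
Proof.
case: i => [|[|[|[|//]]]] _; rewrite /bimodal_rho /bimodal_level /=.
- by rewrite /rho1; ring.
- by rewrite /rho2; ring.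
- by rewrite /rho3; ring.
- by rewrite /rho4; ring.
Qed.

Section LoopNodes.
Variables (a g0 : R).

(* The fixed point of the affine return map over one period. *)
Definition loop_start : R :=
  let r := bimodal_rho in
  g0 * (expR (- a * r 4%N) / (1 - expR (- a * r 4%N))) *
    (2 * expR (a * r 1%N) - 2 * expR (a * r 2%N) + 2 * expR (a * r 3%N)
     - expR (a * r 4%N) - 1).

Fixpoint loop_node (i : nat) : R :=
  if i is j.+1 then ypiece a g0 j (bimodal_rho j) (loop_node j) (bimodal_rho i)
  else loop_start.

Lemma loop_node_periodic : 0 < a -> 0 < bimodal_rho 4%N ->
  loop_node 4%N = loop_node 0%N.
Proof.
rewrite /loop_node /loop_start /bimodal_rho /=.
move: (rho1 _ _ _ _) (rho2 _ _ _ _) (rho3 _ _ _ _) (rho4 _ _ _ _) => r1 r2 r3 r4 a0 r40.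
rewrite !ypieceE subr0 !mulNr !mulrBr !expRN !expRB.
have E4_gt1 : 1 < expR (a * r4) by rewrite expR_gt1 mulr_gt0.
have := (expR_gt0 (a * r1), expR_gt0 (a * r2), expR_gt0 (a * r3)).
move: (expR (a * r1)) (expR (a * r2)) (expR (a * r3)) (expR (a * r4)) E4_gt1.
move=> E1 E2 E3 E4 E4_gt1 [[E1_gt0 E2_gt0] E3_gt0].
by field; rewrite !gt_eqF ?subr_gt0// (lt_trans ltr01).
Qed.

End LoopNodes.

Hypotheses (min_le : umin1 <= umin2) (min_lt_max : umin2 < umax1).
Hypothesis max_le : umax1 <= umax2.

Lemma bimodal_rho_step i : (i < 4)%N ->
  umax1 - umin2 <= bimodal_rho i.+1 - bimodal_rho i.
Proof.
move: min_le min_lt_max max_le => le_min lt_min_max le_max.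
case: i => [|[|[|[|//]]]] _; rewrite /bimodal_rho /=.
- by rewrite /rho1; lra.
- by rewrite /rho2; lra.
- by rewrite /rho3; lra.
- by rewrite /rho4; lra.
Qed.

Lemma bimodal_rho_lt i : (i < 4)%N -> bimodal_rho i < bimodal_rho i.+1.
Proof.
by move=> i4; rewrite -subr_gt0 (lt_le_trans _ (bimodal_rho_step i4))// subr_gt0.
Qed.

Lemma bimodal_rho4_gt0 : 0 < bimodal_rho 4%N.
Proof.
have lt_rho i (i4 : (i < 4)%N) := bimodal_rho_lt i4.
exact: lt_trans (lt_trans (lt_rho 0%N isT) (lt_rho 1%N isT))
                (lt_trans (lt_rho 2%N isT) (lt_rho 3%N isT)).
Qed.

Lemma psi_u_piece i s : (i < 4)%N -> bimodal_rho i <= s <= bimodal_rho i.+1 ->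
  psi_u umin1 umax1 umin2 umax2 s =
  bimodal_level i + (-1) ^+ i * (s - bimodal_rho i).
Proof.
pose F j t := bimodal_level j + (-1) ^+ j * (t - bimodal_rho j).
move=> i4 si; rewrite -[RHS]/(F i s).
rewrite -(@piecewise_if _ F bimodal_rho _ s) ?bimodal_rho_lt//.
  rewrite /psi_u /F /bimodal_rho /bimodal_level/=.
  by do 3?case: ifP => _; rewrite ?exprS ?expr0; ring.
move=> j j3; rewrite /F bimodal_rhoS ?(ltn_trans j3)// subrr mulr0 addr0.
by rewrite addrAC subrr add0r mulrA -expr2 sqrr_sign mul1r addrC subrK.
Qed.

Lemma ycirc_piece s0 (g : R -> R) i s : (i < 4)%N ->
  bimodal_rho i <= s <= bimodal_rho i.+1 ->
  ycirc s0 g umin1 umax1 umin2 umax2 s =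
  ypiece (s0 / g 0) (g 0) i (bimodal_rho i) (loop_node (s0 / g 0) (g 0) i) s.
Proof.
pose F j := ypiece (s0 / g 0) (g 0) j (bimodal_rho j) (loop_node (s0 / g 0) (g 0) j).
move=> i4 si; rewrite -[RHS]/(F i s).
rewrite -(@piecewise_if _ F bimodal_rho _ s) ?bimodal_rho_lt//.
by move=> j _; rewrite /F ypiece_start.
Qed.

Section BimodalInput.
Variables (t1 t2 t3 t4 : R) (u du : R -> R).
Hypotheses (t1_gt0 : 0 < t1) (t12 : t1 < t2) (t23 : t2 < t3) (t34 : t3 < t4).
Hypothesis uW : W1inf_with_deriv u du.
Hypothesis ub : bimodal_input u t1 t2 t3 t4 umin1 umax1 umin2 umax2.

Local Notation V := (cumulative_variation du).

Definition bimodal_time : nat -> R := nth 0 [:: 0; t1; t2; t3; t4].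

Local Notation q := bimodal_time.

Lemma bimodal_time_lt i : (i < 4)%N -> q i < q i.+1.
Proof. by case: i => [|[|[|[|//]]]]. Qed.

Lemma bimodal_time_ge0 i : (i < 4)%N -> 0 <= q i.
Proof.
elim: i => // i IHi i4; have i3 := ltn_trans (ltnSn i) i4.
by rewrite (le_trans (IHi i3))// ltW// bimodal_time_lt.
Qed.

Lemma bimodal_time_cover t : 0 <= t <= t4 ->
  exists2 i, (i < 4)%N & q i <= t <= q i.+1.
Proof.
move=> /andP[t0 tt4].
have [tt1|/ltW t1t] := leP t t1; first by exists 0%N; rewrite ?t0.
have [tt2|/ltW t2t] := leP t t2; first by exists 1%N; rewrite ?t1t.
have [tt3|/ltW t3t] := leP t t3; first by exists 2%N; rewrite ?t2t.
by exists 3%N; rewrite ?t3t.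
Qed.

Lemma bimodal_input_level i : (i <= 4)%N -> u (q i) = bimodal_level i.
Proof.
have [_ _ [u0 u1 u2 u3 u4]] := ub.
by case: i => [|[|[|[|[|//]]]]] _ //; rewrite u4.
Qed.

Lemma bimodal_input_nondecr i : (i < 4)%N ->
  nondecr_on (fun t => (-1) ^+ i * u t) (q i) (q i.+1).
Proof.
have [_ [inc0 dec1 inc2 dec3] _] := ub.
move=> i4 x y qx; rewrite le_eqVlt => /predU1P[->//|xy] yq.
rewrite -signr_odd; case: i i4 qx yq => [|[|[|[|//]]]] _ /= qx yq.
- by rewrite !mul1r ltW// inc0.
- by rewrite !mulN1r lerN2 ltW// dec1.
- by rewrite !mul1r ltW// inc2.
- by rewrite !mulN1r lerN2 ltW// dec3.
Qed.

Lemma bimodal_variationB i t : (i < 4)%N -> q i <= t <= q i.+1 ->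
  V t - V (q i) = (-1) ^+ i * (u t - bimodal_level i).
Proof.
move=> i4 /andP[qt tq]; have qi := ltW (bimodal_time_lt i4).
rewrite -bimodal_input_level ?(ltnW i4)//.
exact: (variation_monotone uW (bimodal_time_ge0 i4) qi (bimodal_input_nondecr i4)).
Qed.

Lemma bimodal_variation_time i : (i <= 4)%N -> V (q i) = bimodal_rho i.
Proof.
elim: i => [_|i IHi i4]; first exact: cumulative_variation0.
have qi : q i <= q i.+1 <= q i.+1 by rewrite lexx ltW// bimodal_time_lt.
rewrite bimodal_rhoS// -IHi ?(ltnW i4)// -(bimodal_input_level i4).
by rewrite -(bimodal_variationB i4 qi) addrC subrK.
Qed.

Lemma bimodal_variation i t : (i < 4)%N -> q i <= t <= q i.+1 ->
  V t = bimodal_rho i + (-1) ^+ i * (u t - bimodal_level i).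
Proof.
move=> i4 tq; rewrite -(bimodal_variationB i4 tq) -bimodal_variation_time ?(ltnW i4)//.
by rewrite addrC subrK.
Qed.

Lemma bimodal_variation_itv i t : (i < 4)%N -> q i <= t <= q i.+1 ->
  bimodal_rho i <= V t <= bimodal_rho i.+1.
Proof.
move=> i4 /andP[qt tq]; have q0 := bimodal_time_ge0 i4.
rewrite -!bimodal_variation_time ?(ltnW i4)//.
by rewrite !(variation_nondecr uW q0 _ _ (lexx _)).
Qed.

Lemma psi_u_variation t : 0 <= t <= t4 -> psi_u umin1 umax1 umin2 umax2 (V t) = u t.
Proof.
move=> /bimodal_time_cover[i i4 tq].
rewrite (psi_u_piece i4 (bimodal_variation_itv i4 tq)) (bimodal_variation i4 tq).
by rewrite [_ + _ - _]addrAC subrr add0r mulrA -expr2 sqrr_sign mul1r addrC subrK.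
Qed.

Section LimitLoop.
Variables (s0 s1 x0 : R) (g f : R -> R) (z : R -> R -> R) (ystar yo : R -> R).
Hypotheses (s0_gt0 : 0 < s0) (s1_ge0 : 0 <= s1).
Hypotheses (gc : continuous g) (g_gt0 : forall th, 0 < g th).
Hypotheses (fc : continuous f) (f0 : f 0 = 0).
Hypothesis zsol :
  forall gamma, 0 < gamma -> caratheodory_sol s0 g du gamma x0 (z gamma).
Hypothesis yg :
  Linf_cvg_gamma (fun gamma => lugre_output s0 s1 g f du gamma (z gamma)) ystar.
Hypothesis yk : Linf_cvg_periods ystar t4 yo.
Hypothesis yoc : {within `[0, t4], continuous yo}.

Lemma ycirc_variation t : 0 <= t <= t4 ->
  ycirc s0 g umin1 umax1 umin2 umax2 (V t) = yo t.
Proof.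
move=> /bimodal_time_cover[i i4 tq].
rewrite (ycirc_piece s0 g i4 (bimodal_variation_itv i4 tq)).
have a_gt0 : 0 < s0 / g 0 by rewrite divr_gt0.
have [u_periodic _ _] := ub.
pose Y := loop_node (s0 / g 0) (g 0).
have YS j : (j < 4)%N -> Y j.+1 = limit_output s0 g du q Y j (q j.+1).
  by move=> j4; rewrite /limit_output !bimodal_variation_time ?(ltnW j4).
have variation_ge j : (j < 4)%N -> umax1 - umin2 <= V (q j.+1) - V (q j).
  by move=> j4; rewrite !bimodal_variation_time ?(ltnW j4)// bimodal_rho_step.
have m_gt0 : 0 < umax1 - umin2 by rewrite subr_gt0.
rewrite -bimodal_variation_time ?(ltnW i4)//; symmetry.
exact: (periodic_limit s0_gt0 g_gt0 uW u_periodic (isT : (0 < 4)%N) isT erefl erefl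
  bimodal_time_lt bimodal_input_nondecr m_gt0 variation_ge YS
  (loop_node_periodic _ a_gt0 bimodal_rho4_gt0)
  s1_ge0 gc fc f0 zsol yg yk yoc i4 tq).
Qed.

Lemma bimodal_loop_image p p' : 0 <= p -> p <= p' -> p' <= t4 ->
  [set (u t, yo t) | t in `[p, p']] =
  [set (psi_u umin1 umax1 umin2 umax2 s, ycirc s0 g umin1 umax1 umin2 umax2 s)
    | s in `[V p, V p']].
Proof.
move=> p_ge0 pp' p't4; apply: image_reparam (pp') _ _ _.
- exact: primitive_continuous (primitive_variation uW p_ge0 pp') pp'.
- by move=> x y px xy yq; exact: (variation_nondecr uW p_ge0 px xy yq).
move=> t /andP[pt tp']; have tt4 : 0 <= t <= t4.
  by rewrite (le_trans p_ge0)// (le_trans tp').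
by rewrite psi_u_variation// ycirc_variation.
Qed.

End LimitLoop.

End BimodalInput.
End BimodalLoop.

Theorem theoremA (R : realType) (sigma0 sigma1 : R) (g f : R -> R) (x0 : R)
  (umin1 umax1 umin2 umax2 t1 t2 t3 t4 t5 : R) (u du : R -> R)
  (z : R -> R -> R) (ystar yo : R -> R) :
  0 < sigma0 -> 0 < sigma1 ->
  continuous g -> (forall th, 0 < g th) ->
  continuous f -> f 0 = 0 ->
  umin1 <= umin2 -> umin2 < umax1 -> umax1 <= umax2 ->
  (umin1 != umin2 \/ umax1 != umax2) ->
  0 < t1 -> t1 < t2 -> t2 < t3 -> t3 < t4 ->
  W1inf_with_deriv u du ->
  bimodal_input u t1 t2 t3 t4 umin1 umax1 umin2 umax2 ->
  (forall gamma, 0 < gamma -> caratheodory_sol sigma0 g du gamma x0 (z gamma)) ->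
  Linf_cvg_gamma (fun gamma => lugre_output sigma0 sigma1 g f du gamma (z gamma))
    ystar ->
  Linf_cvg_periods ystar t4 yo ->
  {within `[0, t4], continuous yo} ->
  t2 < t5 -> t5 <= t3 -> u t5 = u t1 ->
  [set (u t, yo t) | t in `[0, t4]] =
    [set (psi_u umin1 umax1 umin2 umax2 t, ycirc sigma0 g umin1 umax1 umin2 umax2 t)
      | t in `[0, rho4 umin1 umax1 umin2 umax2]]
  /\
  [set (u t, yo t) | t in `[t1, t5]] =
    [set (psi_u umin1 umax1 umin2 umax2 t, ycirc sigma0 g umin1 umax1 umin2 umax2 t)
      | t in `[rho1 umin1 umax1 umin2 umax2, rho5 umin1 umax1 umin2 umax2]].
Proof.
move=> s0_gt0 s1_gt0 gc g_gt0 fc f0 min_le min_lt_max max_le _ t1_gt0 t12 t23 t34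
  uW ub zsol yg yk yoc t25 t53 ut5.
pose V := cumulative_variation du.
have V_time i (i4 : (i <= 4)%N) :=
  bimodal_variation_time t1_gt0 t12 t23 t34 uW ub i4.
have [V0 V1 V4] : [/\ V 0 = 0, V t1 = rho1 umin1 umax1 umin2 umax2 &
    V t4 = rho4 umin1 umax1 umin2 umax2].
  by split; [exact: (V_time 0%N)|exact: (V_time 1%N)|exact: (V_time 4%N)].
have V5 : V t5 = rho5 umin1 umax1 umin2 umax2.
  have [_ _ [_ u1 _ _ _]] := ub.
  have t5_piece : t2 <= t5 <= t3 by rewrite ltW.
  rewrite /V (bimodal_variation t1_gt0 t12 t23 t34 uW ub (isT : 2 < 4)%N t5_piece).
  by rewrite ut5 u1 sqrrN expr1n mul1r /rho5 addrC.
have loop_image p q := bimodal_loop_image (p := p) (p' := q)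
  min_le min_lt_max max_le t1_gt0 t12 t23 t34 uW ub
  s0_gt0 (ltW s1_gt0) gc g_gt0 fc f0 zsol yg yk yoc.
by split; rewrite loop_image -/V ?V0 ?V1 ?V4 ?V5//; lra.
Qed.
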